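(* Let $p$ be a prime and $r\in\mathbb{Z}$. Consider $Powerset(\omega)$, the Boolean algebra of all subsets of $\omega$, as a structure with the Boolean operations $0,1,\cap,\cup,\neg$, the predicates $C_k$ ($k\geq1$) where $C_k(x)$ means $x$ has at least $k$ elements, the predicate $Fin(x)$ meaning $x$ is finite, and, for every prime $q\neq p$, every $m\geq 1$ and every $s\in\mathbb{Z}$, the predicate $Res(q^m,s)(x)$ meaning $x$ is finite and $|x|\equiv s\pmod{q^m}$. Then the set $\{x\subseteq\omega: x \text{ finite and } |x|\equiv r\pmod p\}$ is not definable in this structure (by a formula with one free variable and no parameters). *)

(* Defs.v *)
From mathcomp Require Import all_boot all_order all_algebra.
From mathcomp Require Import finmap.
From mathcomp Require Import mathcomp_extra boolp classical_sets functions.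
From mathcomp Require Import cardinality.

Set Implicit Arguments.
Unset Strict Implicit.
Unset Printing Implicit Defensive.

Import GRing.Theory.

Local Open Scope classical_set_scope.
Local Open Scope card_scope.

(* Variables are de Bruijn indices: those of a term or formula indexed by n
   lie in 'I_n, and a quantifier binds the index ord0 of its body. *)
Inductive term (n : nat) : Type :=
| tVar of 'I_n
| tZero
| tOne
| tCap of term n & term n
| tCup of term n & term n
| tNeg of term n.

Inductive formula (p n : nat) : Type :=
| fEq of term n & term n
| fC (k : nat) of (1 <= k)%N & term n
| fFin of term n
| fRes (q m : nat) (s : int) of prime q & q != p & (1 <= m)%N & term n
| fNot of formula p n
| fAnd of formula p n & formula p n
| fOr of formula p n & formula p n
| fImp of formula p n & formula p n
| fAll of formula p n.+1
| fEx of formula p n.+1.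

Fixpoint eval n (v : 'I_n -> set nat) (t : term n) : set nat :=
  match t with
  | tVar i => v i
  | tZero => set0
  | tOne => setT
  | tCap t1 t2 => eval v t1 `&` eval v t2
  | tCup t1 t2 => eval v t1 `|` eval v t2
  | tNeg t1 => ~` eval v t1
  end.

(* The finiteness conjunct matters: fset_set is empty on infinite sets. *)
Definition fin_card_mod (d : nat) (s : int) : set (set nat) :=
  [set x | finite_set x /\ (#|` fset_set x|%:Z = s %[mod d%:Z])%Z].

Definition extend n (a : set nat) (v : 'I_n -> set nat) (i : 'I_n.+1) :
    set nat :=
  if unlift ord0 i is Some j then v j else a.

Fixpoint sat p n (v : 'I_n -> set nat) (f : formula p n) : Prop :=
  match f with
  | fEq t1 t2 => eval v t1 = eval v t2
  | fC k _ t => `I_k #<= eval v t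
  | fFin t => finite_set (eval v t)
  | fRes q m s _ _ _ t => fin_card_mod (q ^ m) s (eval v t)
  | fNot g => ~ sat v g
  | fAnd g h => sat v g /\ sat v h
  | fOr g h => sat v g \/ sat v h
  | fImp g h => sat v g -> sat v h
  | fAll g => forall a : set nat, sat (extend a v) g
  | fEx g => exists a : set nat, sat (extend a v) g
  end.

Definition definable (p : nat) (X : set (set nat)) : Prop :=
  exists f : formula p 1, forall x : set nat, X x <-> sat (fun=> x) f.

(* Main.v *)
Require Import Defs.
From mathcomp Require Import all_boot all_order all_algebra.
From mathcomp Require Import finmap zify.
From mathcomp Require Import mathcomp_extra boolp classical_sets functions.
From mathcomp Require Import cardinality.

(** An Ehrenfeucht-Fraisse argument.  Let N be the product of the moduli of a
    formula f; it is prime to p.  Two tuples of sets are compared through the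
    cells of the partitions of omega they generate: corresponding cells must
    have the same cardinality, or be finite, of cardinality at least B, and
    congruent mod N.  Equivalence at 2B + N allows a back-and-forth step to
    equivalence at B, so at large enough B equivalent tuples agree on f.  Initial
    segments of lengths a and a + N, with a large and congruent to r mod p, are
    then indistinguishable by f, although p does not divide N. *)

Local Open Scope classical_set_scope.
Local Open Scope card_scope.

(** * Cardinalities of disjoint unions and of complementary parts *)

Lemma card_eq_setU T (U : pointedType) (X X' : set T) (Y Y' : set U) :
  X `&` X' = set0 -> Y `&` Y' = set0 ->
  X #= Y -> X' #= Y' -> X `|` X' #= Y `|` Y'.
Proof.
move=> /disj_set2P XX' /disj_set2P YY' /pcard_eqP[f] /pcard_eqP[g].
by apply/pcard_eqP; squash (glue XX' YY' f g).
Qed.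

Lemma card_eq_setU_II T (X X' : set T) (a b : nat) :
  X `&` X' = set0 -> X #= `I_a -> X' #= `I_b -> X `|` X' #= `I_(a + b).
Proof.
move=> XX' Xa Xb.
have -> : `I_(a + b) = `I_a `|` (`I_(a + b) `\` `I_a).
  by rewrite setDUK // => i /= /leq_trans; apply; exact: leq_addr.
apply: card_eq_setU => //; first exact: setDIK.
by rewrite (card_eqr card_IID) addKn.
Qed.

(** The image of [X1] under a bijection works: injectivity makes the complements correspond. *)
Lemma card_eq_split {T} {U : pointedType} {X X1 : set T} {Y : set U} :
  X #= Y -> X1 `<=` X ->
  exists Y1, [/\ Y1 `<=` Y, X1 #= Y1 & X `\` X1 #= Y `\` Y1].
Proof.
move=> /card_set_bijP[f [fXY finj fsurj]] X1X; exists (f @` X1).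
have image_eq Z : Z `<=` X -> Z #= f @` Z.
  move=> ZX; apply/card_esym/inj_card_eq => x y /set_mem xZ /set_mem yZ.
  by apply: finj; apply/mem_set; apply: ZX.
split.
- by move=> _ [x /X1X /fXY fx <-].
- exact: image_eq.
suff -> : Y `\` f @` X1 = f @` (X `\` X1) by apply: image_eq; exact: subDsetl.
apply/seteqP; split=> [y [/fsurj[x Xx <-] nX1]|_ [x [Xx nX1x] <-]].
  by exists x => //; split=> // X1x; apply: nX1; exists x.
split; first exact: fXY.
case=> z X1z /finj zx; apply: nX1x.
by rewrite -zx //; apply: mem_set => //; exact: X1X.
Qed.

(** * Similarity of sets of natural numbers *)

Definition similar (N B : nat) (X Y : set nat) : Prop :=
  X #= Y \/ exists a b : nat,
    [/\ X #= `I_a, Y #= `I_b, (B <= a)%N, (B <= b)%N & a = b %[mod N]].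

Lemma similar_sym N B X Y : similar N B X Y -> similar N B Y X.
Proof.
case=> [/card_esym|[a [b [Xa Yb Ba Bb ab]]]]; first by left.
by right; exists b, a.
Qed.

Lemma similar_leq {N B B' X Y} :
  (B' <= B)%N -> similar N B X Y -> similar N B' X Y.
Proof.
move=> B'B [|[a [b [Xa Yb Ba Bb ab]]]]; first by left.
by right; exists a, b; split=> //; [apply: leq_trans Ba|apply: leq_trans Bb].
Qed.

Lemma similar_finite {N B X Y} :
  similar N B X Y -> finite_set X <-> finite_set Y.
Proof.
case=> [/eq_finite_set ->|[a [b [Xa Yb _ _ _]]]] //.
by split=> _; apply/finite_setP; [exists b|exists a].
Qed.

Lemma infinite_nat_card_eq (X Y : set nat) :
  infinite_set X -> infinite_set Y -> X #= Y.
Proof.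
move=> /(eq_card_nat (countableP X)) XT /(eq_card_nat (countableP Y)) YT.
by rewrite (card_eql XT) card_eq_sym.
Qed.

(** An infinite union has an infinite part, whose counterpart is infinite too, and infinite subsets
    of [nat] are equipotent. In the finite case an exactly copied part shifts both sizes by the same
    amount, while a part known only mod [N] already brings both sizes up to [B]. *)
Lemma similar_setU N B X X' Y Y' :
  X `&` X' = set0 -> Y `&` Y' = set0 ->
  similar N B X Y -> similar N B X' Y' -> similar N B (X `|` X') (Y `|` Y').
Proof.
move=> XX' YY' sXY sXY'.
have [fX|iX] := pselect (finite_set (X `|` X')); last first.
  left; apply: infinite_nat_card_eq => //.
  move: iX; rewrite !finite_setU.
  by rewrite (propext (similar_finite sXY)) (propext (similar_finite sXY')).
move: fX; rewrite finite_setU => -[/finite_setP[c Xc] /finite_setP[d Xd]].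
case: sXY => [XY|[a [b [Xa Yb Ba Bb ab]]]];
  case: sXY' => [XY'|[a' [b' [Xa' Yb' Ba' Bb' ab']]]].
- by left; apply: card_eq_setU.
- right; exists (c + a'), (c + b'); split; try lia.
  + exact: card_eq_setU_II.
  + by apply: card_eq_setU_II; rewrite // -(card_eql XY).
  + by rewrite -modnDmr ab' modnDmr.
- right; exists (a + d), (b + d); split; try lia.
  + exact: card_eq_setU_II.
  + by apply: card_eq_setU_II; rewrite // -(card_eql XY').
  + by rewrite -modnDml ab modnDml.
- right; exists (a + a'), (b + b'); split; try lia.
  + exact: card_eq_setU_II.
  + exact: card_eq_setU_II.
  + by rewrite -modnDml ab modnDml -modnDmr ab' modnDmr.
Qed.

(* A part smaller than B is copied exactly; when both parts are at least B, the
   first is replaced by its representative mod N in [B, B + N[. *)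
Lemma split_nat {N B i j b : nat} : (0 < N)%N ->
    (B.*2 + N <= i + j)%N -> (B.*2 + N <= b)%N -> i + j = b %[mod N] ->
  exists i' j', [/\ i' + j' = b,
    i = i' \/ [/\ (B <= i)%N, (B <= i')%N & i = i' %[mod N]] &
    j = j' \/ [/\ (B <= j)%N, (B <= j')%N & j = j' %[mod N]]].
Proof.
move=> N0 Bij Bb ijb.
have [iB|Bi] := ltnP i B.
  exists i, (b - i); split; [lia|by left|right; split; try lia].
  by apply/eqP; rewrite -(eqn_modDl i) ijb subnKC //; lia.
have [jB|Bj] := ltnP j B.
  exists (b - j), j; split; [lia|right; split; try lia|by left].
  by apply/eqP; rewrite -(eqn_modDr j) ijb subnK //; lia.
have lN := ltn_pmod (i - B) N0.
set i' := B + (i - B) %% N.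
have ii' : i = i' %[mod N] by rewrite /i' modnDmr subnKC.
exists i', (b - i'); split; [lia|right; split=> //; lia|right; split; try lia].
by apply/eqP; rewrite -(eqn_modDl i) ijb -modnDml ii' modnDml subnKC //; lia.
Qed.

(** A bijection carries [X1] across; otherwise both sets are finite and [split_nat] chooses the
    sizes of the two parts of [Y]. The bound [B.*2 + N] leaves room for a representative below
    [B + N] and a remainder of at least [B]. *)
Lemma similar_split {N B X Y X1} : (0 < N)%N -> X1 `<=` X ->
    similar N (B.*2 + N) X Y ->
  exists Y1, [/\ Y1 `<=` Y, similar N B X1 Y1 &
                 similar N B (X `\` X1) (Y `\` Y1)].
Proof.
move=> N0 X1X [XY|[a [b [Xa Yb Ba Bb ab]]]].
  by have [Y1 [? ? ?]] := card_eq_split XY X1X; exists Y1; split=> //; left.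
have fX : finite_set X by apply/finite_setP; exists a.
have /finite_setP[i X1i] : finite_set X1 by apply: sub_finite_set fX.
have /finite_setP[j X2j] : finite_set (X `\` X1) by apply: finite_setD.
have aij : a = i + j.
  apply/card_eq_II; rewrite -(card_eql Xa) -(setDUK X1X).
  by apply: card_eq_setU_II => //; exact: setDIK.
rewrite {}aij in Ba ab.
have [i' [j' [bij ii' jj']]] := split_nat N0 Ba Bb ab.
have i'b : (i' <= b)%N by lia.
have sI : `I_i' `<=` `I_b by move=> k /= /leq_trans; apply.
(* The part of [Y] is the copy of an initial segment of [I_b], which leaves [b - i' = j']
   elements. *)
have [Y1 []] := card_eq_split (card_esym Yb) sI.
rewrite (card_eql card_IID) => Y1Y Y1i Y2j.
have {}Y2j : `I_j' #= Y `\` Y1 by rewrite -(_ : b - i' = j') //; lia.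
exists Y1; split=> //.
- case: ii' => [ii'|[? ? ?]]; first by left; rewrite (card_eql X1i) ii'.
  by right; exists i, i'; split=> //; apply: card_esym.
- case: jj' => [jj'|[? ? ?]]; first by left; rewrite (card_eql X2j) jj'.
  by right; exists j, j'; split=> //; apply: card_esym.
Qed.

(** * Cells, equivalence of tuples and the back-and-forth step *)

Definition cell {n} (v : 'I_n -> set nat) (x : nat) : {ffun 'I_n -> bool} :=
  [ffun i => x \in v i].

Definition equivalent (N B : nat) {n} (v w : 'I_n -> set nat) : Prop :=
  forall s, similar N B [set x | cell v x = s] [set x | cell w x = s].

Lemma equivalent_sym {N B n} {v w : 'I_n -> set nat} :
  equivalent N B v w -> equivalent N B w v.
Proof. by move=> vw s; apply: similar_sym. Qed.

Lemma equivalent_leq {N B B' n} {v w : 'I_n -> set nat} :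
  (B' <= B)%N -> equivalent N B v w -> equivalent N B' v w.
Proof. by move=> B'B vw s; apply: similar_leq (vw s). Qed.

(** Since [T] is finite, each side is a disjoint union of finitely many fibers, which [similar_setU]
    adds one at a time. *)
Lemma similar_fibers {N B} {T : finType} {f g : nat -> T} (P : pred T) :
  (forall s, similar N B [set x | f x = s] [set x | g x = s]) ->
  similar N B [set x | P (f x)] [set x | P (g x)].
Proof.
move=> fg.
suff fgS (S : seq T) : uniq S ->
    similar N B [set x | f x \in S] [set x | g x \in S].
  have E (h : nat -> T) : [set x | P (h x)] = [set x | h x \in enum P].
    by apply/seteqP; split=> x; rewrite /= mem_enum.
  by rewrite !E; apply: fgS; exact: enum_uniq.
elim: S => [|s S IH] /=; first by left; exact: card_eqxx.
move=> /andP[sS uS].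
have E (h : nat -> T) : [set x | h x \in s :: S] =
    [set x | h x = s] `|` [set x | h x \in S].
  apply/seteqP; split=> x /=; rewrite inE.
    by case/orP=> [/eqP|]; [left|right].
  by case=> [/eqP|] ->; rewrite ?orbT.
have D (h : nat -> T) : [set x | h x = s] `&` [set x | h x \in S] = set0.
  by apply/seteqP; split=> x //= -[-> ]; apply/negP.
by rewrite !E; apply: similar_setU (fg s) (IH uS).
Qed.

(** Boolean operations act pointwise: a term, read as a propositional formula, decides from the
    membership pattern [s] of a point whether the point lies in its value. *)
Fixpoint holds {n} (s : 'I_n -> bool) (t : term n) : bool :=
  match t with
  | tVar i => s i
  | tZero => false
  | tOne => true
  | tCap t1 t2 => holds s t1 && holds s t2
  | tCup t1 t2 => holds s t1 || holds s t2
  | tNeg t1 => ~~ holds s t1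
  end.

Lemma evalE n (v : 'I_n -> set nat) (t : term n) :
  eval v t = [set x | holds (cell v x) t].
Proof.
elim: t => [i|||t1 IH1 t2 IH2|t1 IH1 t2 IH2|t1 IH1] /=.
- by apply/seteqP; split=> x /=; rewrite ffunE inE.
- by apply/seteqP; split.
- by apply/seteqP; split.
- by rewrite IH1 IH2; apply/seteqP; split=> x /= /andP.
- by rewrite IH1 IH2; apply/seteqP; split=> x /= /orP.
- by rewrite IH1; apply/seteqP; split=> x /= /negP.
Qed.

Lemma similar_eval {N B n} {v w : 'I_n -> set nat} (t : term n) :
  equivalent N B v w -> similar N B (eval v t) (eval w t).
Proof.
move=> vw; rewrite !evalE.
exact: (similar_fibers (fun s : {ffun 'I_n -> bool} => holds s t)).
Qed.

Lemma cell_extend n (a : set nat) (v : 'I_n -> set nat) x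
    (s : {ffun 'I_n.+1 -> bool}) :
  (cell (extend a v) x = s) <->
  (cell v x = [ffun i => s (lift ord0 i)]) /\ (x \in a) = s ord0.
Proof.
split=> [<-|[/ffunP E xa]].
  split; last by rewrite ffunE /extend unlift_none.
  by apply/ffunP => i; rewrite !ffunE /extend liftK.
apply/ffunP => i; rewrite ffunE /extend.
by case: unliftP => [j ->|-> //]; have := E j; rewrite !ffunE.
Qed.

(** The set [a] cuts every cell of [v] in two; [similar_split] cuts the corresponding cell of [w] to
    match. *)
Lemma equivalent_extend {N B n} {v w : 'I_n -> set nat} (a : set nat) :
  (0 < N)%N -> equivalent N (B.*2 + N) v w ->
  exists b, equivalent N B (extend a v) (extend b w).
Proof.
move=> N0 vw.
have /choice[Y YP] : forall s, exists Y1, [/\ Y1 `<=` [set x | cell w x = s],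
    similar N B ([set x | cell v x = s] `&` a) Y1 &
    similar N B ([set x | cell v x = s] `\` a)
                ([set x | cell w x = s] `\` Y1)].
  move=> s; have [Y1] := similar_split N0 (@subIsetl _ _ a) (vw s).
  by rewrite setDIr setDv set0U; exists Y1.
(* The witness is the union of the chosen parts; cells being disjoint, its trace on the cell [s] is
   exactly [Y s]. *)
exists [set y | Y (cell w y) y] => s.
have E (u : 'I_n -> set nat) (c : set nat) :
    [set x | cell (extend c u) x = s] =
    let A := [set x | cell u x = [ffun i => s (lift ord0 i)]] in
    if s ord0 then A `&` c else A `\` c.
  apply/seteqP; split=> x /=; rewrite cell_extend; case: (s ord0).
  - by case=> ? /set_mem.
  - by case=> ? /negbT; rewrite notin_setE.
  - by case=> ? /mem_set.
  - by case=> ? xc; split=> //; apply/negbTE; rewrite notin_setE.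
rewrite !E /=; have [YS Y1 Y2] := YP [ffun i => s (lift ord0 i)].
case: (s ord0).
- congr similar: Y1; apply/seteqP; split=> [x Yx|x [/= -> //]].
  by split; [exact: YS|rewrite /= (YS _ Yx)].
- congr similar: Y2; apply/seteqP.
  by split=> x [/= <- nY]; split.
Qed.

(** * Preservation of satisfaction under equivalence *)

Fixpoint modulus {p n} (f : formula p n) : nat :=
  match f with
  | fEq _ _ | fC _ _ _ | fFin _ => 1
  | fRes q m _ _ _ _ _ => q ^ m
  | fNot g | fAll g | fEx g => modulus g
  | fAnd g h | fOr g h | fImp g h => modulus g * modulus h
  end.

(** Equality needs 1, to tell empty sets from nonempty ones; finiteness and residues need 0, being
    preserved by similarity at any bound; a quantifier costs one back-and-forth step. *)
Fixpoint threshold (N : nat) {p n} (f : formula p n) : nat :=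
  match f with
  | fEq _ _ => 1
  | fC k _ _ => k
  | fFin _ | fRes _ _ _ _ _ _ _ => 0
  | fNot g => threshold N g
  | fAnd g h | fOr g h | fImp g h => maxn (threshold N g) (threshold N h)
  | fAll g | fEx g => (threshold N g).*2 + N
  end.

Lemma coprime_modulus {p n} (f : formula p n) :
  prime p -> coprime p (modulus f).
Proof.
move=> hp; elim: f => {n} //=.
1-3: by move=> *; exact: coprimen1.
  move=> n q m _ hq qp _ _; apply: coprimeXr.
  by rewrite prime_coprime // dvdn_prime2 // eq_sym.
all: by move=> n g IHg h IHh; rewrite coprimeMr IHg.
Qed.

Lemma similar_set0 N B X Y :
  (0 < B)%N -> similar N B X Y -> X = set0 -> Y = set0.
Proof.
move=> B0 [XY|[a [b [Xa Yb Ba Bb ab]]]] X0.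
  by apply/eqP; move: XY; rewrite X0 card_eq_sym card_eq0.
by move: Xa; rewrite X0 -II0 => /card_eq_II a0; move: Ba B0; rewrite -a0; lia.
Qed.

Lemma similar_card_ge N B k X Y : (k <= B)%N -> similar N B X Y ->
  `I_k #<= X -> `I_k #<= Y.
Proof.
move=> kB [XY|[a [b [Xa Yb Ba Bb ab]]]]; first by rewrite (card_le_eqr XY).
by move=> _; rewrite (card_le_eqr Yb) card_le_II; exact: leq_trans Bb.
Qed.

Lemma similar_fin_card_mod N B d s X Y : (d %| N)%N -> similar N B X Y ->
  fin_card_mod d s X -> fin_card_mod d s Y.
Proof.
move=> dN XY [fX Xs]; have fY := (similar_finite XY).1 fX; split=> //.
rewrite -Xs; case: XY => [/(fcard_eq fX fY) -> //|[a [b [Xa Yb _ _ ab]]]].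
rewrite (card_fset_set Xa) (card_fset_set Yb) !modz_nat; congr Posz.
by rewrite -(modn_dvdm a dN) ab modn_dvdm.
Qed.

(** This turns an equation into the emptiness of a single term, which similarity controls. *)
Lemma eval_eq_symdiff n (v : 'I_n -> set nat) (t1 t2 : term n) :
  eval v t1 = eval v t2 <->
  eval v (tCup (tCap t1 (tNeg t2)) (tCap t2 (tNeg t1))) = set0.
Proof.
rewrite /= -!setDE setU_eq0 !setD_eq0; split=> [->|[? ?]]; first by split.
exact/seteqP.
Qed.

(** One implication suffices because equivalence is symmetric. [N] is any positive multiple of the
    modulus, so that it stays fixed when passing to subformulas, while [B] varies in the
    induction. *)
Lemma sat_equivalent N B p n (f : formula p n) (v w : 'I_n -> set nat) :
  (0 < N)%N -> (modulus f %| N)%N -> (threshold N f <= B)%N ->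
  equivalent N B v w -> sat v f -> sat w f.
Proof.
have dvd_mul k l : (k * l %| N -> k %| N /\ l %| N)%N.
  move=> kl; split; apply: dvdn_trans kl; first exact: dvdn_mulr.
  exact: dvdn_mull.
have le_max k l b : (maxn k l <= b -> k <= b /\ l <= b)%N.
  by rewrite geq_max => /andP.
move=> N0; elim: f B v w => {n}
  [n t1 t2|n k k0 t|n t|n q m s hq qp hm t|n g IHg|n g IHg h IHh
  |n g IHg h IHh|n g IHg h IHh|n g IHg|n g IHg] B v w //= dN leB vw.
- by rewrite !eval_eq_symdiff; apply: similar_set0 leB _; exact: similar_eval.
- by apply: similar_card_ge leB _; exact: similar_eval.
- by rewrite (propext (similar_finite (similar_eval t vw))).
- by apply: similar_fin_card_mod dN _; exact: similar_eval.
- by move=> nvg wg; apply: nvg; apply: IHg (equivalent_sym vw) wg.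
- have [[gN hN] [gB hB]] := (dvd_mul _ _ dN, le_max _ _ _ leB).
  by case=> vg vh; split; [exact: IHg vw vg|exact: IHh vw vh].
- have [[gN hN] [gB hB]] := (dvd_mul _ _ dN, le_max _ _ _ leB).
  by case=> [vg|vh]; [left; exact: IHg vw vg|right; exact: IHh vw vh].
- have [[gN hN] [gB hB]] := (dvd_mul _ _ dN, le_max _ _ _ leB).
  move=> vgh wg; have vg := IHg _ _ _ gN gB (equivalent_sym vw) wg.
  exact: IHh vw (vgh vg).
(* Here the back-and-forth step runs from [w] to [v]. *)
- move=> vg b; have wv := equivalent_sym (equivalent_leq leB vw).
  have [a ab] := equivalent_extend b N0 wv.
  exact: IHg (equivalent_sym ab) (vg a).
- move=> [a vg].
  have [b ab] := equivalent_extend a N0 (equivalent_leq leB vw).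
  by exists b; exact: IHg ab vg.
Qed.

(** * Indistinguishable initial segments *)

(** There are only two cells, the segment and its complement, and the complements are both
    infinite. *)
Lemma equivalent_II N B a b : (B <= a)%N -> (B <= b)%N -> a = b %[mod N] ->
  equivalent N B (fun _ : 'I_1 => `I_a) (fun=> `I_b).
Proof.
move=> Ba Bb ab s.
have E c : [set x | cell (fun _ : 'I_1 => `I_c) x = s] =
    if s ord0 then `I_c else ~` `I_c.
  apply/seteqP; split=> x /=.
    by move=> <-; rewrite ffunE; case: ifPn => [/set_mem|]; rewrite ?notin_setE.
  move=> sx; apply/ffunP => i; rewrite ffunE (ord1 i).
  case: (s ord0) sx => [/mem_set //|sx].
  by apply/negbTE; rewrite notin_setE.
rewrite !E; case: (s ord0).
  by right; exists a, b; split=> //; exact: card_eqxx.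
left; apply: infinite_nat_card_eq; rewrite -setTD; apply: infinite_setD => //.
  exact: infinite_nat.
exact: infinite_nat.
Qed.

Theorem theorem5 (p : nat) (r : int) (hp : prime p) :
  ~ definable p
      [set x : set nat |
        finite_set x /\ (#|` fset_set x|%:Z = r %[mod p%:Z])%Z].
Proof.
move=> [f fP]; set N := modulus f; set B := threshold N f.
have copN : coprime p N := coprime_modulus f hp.
have N0 : (0 < N)%N.
  rewrite lt0n; apply: contraL copN => /eqP ->.
  by rewrite /coprime gcdn0 neq_ltn prime_gt1 ?orbT.
(* The residue of [r] in [[0, p[] fixes the class mod [p]; adding [B * p] keeps it and reaches
   [B]. *)
pose a := (absz (r %% p)%Z + B * p)%N.
have Ba : (B <= a)%N by rewrite /a; have := prime_gt0 hp; nia.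
have ra : (a%:Z = r %[mod p%:Z])%Z.
  have p0 : (p%:Z != 0)%Z by rewrite eqz_nat -lt0n prime_gt0.
  by rewrite /a PoszD PoszM gez0_abs ?modz_ge0 // GRing.addrC modzMDl modz_mod.
have /fP fa : finite_set `I_a /\ (#|` fset_set `I_a|%:Z = r %[mod p%:Z])%Z.
  by split=> //; rewrite (card_fset_set (card_eqxx _)).
(* Now [f] also accepts [a + N], so [a + N] and [a] agree mod [p]; hence [p] divides [N], against
   coprimality. *)
have /fP[_] : sat (fun=> `I_(a + N)) f.
  apply: sat_equivalent N0 _ (leqnn B) _ fa => //.
  by apply: equivalent_II; rewrite ?modnDr //; lia.
rewrite (card_fset_set (card_eqxx _)) -ra !modz_nat => -[/eqP].
rewrite -{2}(addn0 a) eqn_modDl mod0n => pN.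
by move: copN; rewrite prime_coprime // /dvdn pN.
Qed.
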